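(* Suppose Assumptions A and C hold, and suppose that for every semidefinite face $\mathcal F$ of $\Gamma$, $$\dim(\mathcal V(\mathcal F))\ \ge\ \operatorname{affdim}(\{b(\gamma):\gamma\in\mathcal F\})+1.$$ Then $\operatorname{conv}(\mathcal D)=\mathcal D_{\mathrm{SDP}}$ and $\mathrm{Opt}=\mathrm{Opt}_{\mathrm{SDP}}$.
   Context: Fix integers $N\ge 1$, $m_I,m_E\ge 0$, $m:=m_I+m_E\ge 1$; $[a,b]=\{a,\dots,b\}$, $[n]=[1,n]$. For $i\in[0,m]$ let $q_i(x)=x^\top A_ix+2b_i^\top x+c_i$ with $A_i\in\mathbb S^N$, $b_i\in\mathbb R^N$, $c_i\in\mathbb R$. $\mathrm{Opt}:=\inf\{q_0(x): q_i(x)\le 0\ \forall i\in[m_I],\ q_i(x)=0\ \forall i\in[m_I+1,m]\}$; $\mathcal D:=\{(x,t)\in\mathbb R^N\times\mathbb R: q_0(x)\le 2t,\ q_i(x)\le0\ \forall i\in[m_I],\ q_i(x)=0\ \forall i\in[m_I+1,m]\}$. Let $Q_i=\begin{pmatrix}c_i& b_i^\top\\ b_i& A_i\end{pmatrix}$; $\mathrm{Opt}_{\mathrm{SDP}}:=\inf\{\langle Q_0,Y\rangle: Y=\begin{pmatrix}1&x^\top\\ x& X\end{pmatrix}\succeq 0,\ X\in\mathbb S^N,\ \langle Q_i,Y\rangle\le 0\ \forall i\in[m_I],\ \langle Q_i,Y\rangle=0\ \forall i\in[m_I+1,m]\}$ and $\mathcal D_{\mathrm{SDP}}:=\{(x,t):\exists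 X\in\mathbb S^N$ with $Y=\begin{pmatrix}1&x^\top\\ x& X\end{pmatrix}\succeq0$, $\langle Q_0,Y\rangle\le 2t$, and the same constraints$\}$. For $\gamma\in\mathbb R^m$: $A(\gamma)=A_0+\sum\gamma_iA_i$, $b(\gamma)=b_0+\sum\gamma_ib_i$; $\Gamma:=\{\gamma\in\mathbb R^m: A(\gamma)\succeq0,\ \gamma_i\ge0\ \forall i\in[m_I]\}$. Assumption A: the QCQP feasible set is nonempty and some $\gamma^*$ with $\gamma^*_i\ge0$ ($i\in[m_I]$) has $A(\gamma^* )\succ0$. Assumption C: $\Gamma$ is a polyhedron. A nonempty face $\mathcal F$ of $\Gamma$ is definite if some $\gamma\in\mathcal F$ has $A(\gamma)\succ0$, semidefinite otherwise; $\mathcal V(\mathcal F):=\{v\in\mathbb R^N: A(\gamma)v=0\ \forall \gamma\in\mathcal F\}$. $\operatorname{affdim}$ is the dimension of the affine hull. *)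

(* Defs.v *)
(* The scalar field is an arbitrary Dedekind-complete
   ordered field R (realFieldType + least-upper-bound property), i.e. R is
   (isomorphic to) the real numbers. *)
From HB Require Import structures.
From mathcomp Require Import all_boot all_order all_algebra.
Set Implicit Arguments. Unset Strict Implicit. Unset Printing Implicit Defensive.
Import Order.TTheory GRing.Theory Num.Theory.
Local Open Scope ring_scope.

Section QCQP.
Variable R : realFieldType.

Definition complete_field : Prop :=
  forall E : R -> Prop, (exists x, E x) -> (exists M, forall x, E x -> x <= M) ->
  exists s, (forall x, E x -> x <= s) /\ (forall M, (forall x, E x -> x <= M) -> s <= M).

Definition symmx n (M : 'M[R]_n) : Prop := M^T = M.
Definition psd n (M : 'M[R]_n) : Prop :=
  symmx M /\ forall v : 'rV[R]_n, 0 <= (v *m M *m v^T) 0 0.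
Definition pd n (M : 'M[R]_n) : Prop :=
  symmx M /\ forall v : 'rV[R]_n, v != 0 -> 0 < (v *m M *m v^T) 0 0.

Definition frob n (P Y : 'M[R]_n) : R := \sum_(i < n) \sum_(j < n) P i j * Y i j.

Variables (N mI mE : nat).
Local Notation m := (mI + mE)%N.
(* data: index 0 = objective, index lift ord0 i = constraint i+1 (i : 'I_m) *)
Variables (A : 'I_m.+1 -> 'M[R]_N) (b : 'I_m.+1 -> 'rV[R]_N) (c : 'I_m.+1 -> R).

Definition q (i : 'I_m.+1) (x : 'rV[R]_N) : R :=
  (x *m A i *m x^T) 0 0 + 2 * (b i *m x^T) 0 0 + c i.

Definition cons (i : 'I_m) : 'I_m.+1 := lift ord0 i.

Definition feasible (x : 'rV[R]_N) : Prop :=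
  (forall i : 'I_m, (i < mI)%N -> q (cons i) x <= 0) /\
  (forall i : 'I_m, (mI <= i)%N -> q (cons i) x = 0).

Definition D (x : 'rV[R]_N) (t : R) : Prop := q ord0 x <= 2 * t /\ feasible x.

Definition Qmat (i : 'I_m.+1) : 'M[R]_(1 + N) :=
  block_mx (c i)%:M (b i) (b i)^T (A i).

Definition Ymat (x : 'rV[R]_N) (X : 'M[R]_N) : 'M[R]_(1 + N) :=
  block_mx 1 x x^T X.

Definition sdp_feasible (x : 'rV[R]_N) (X : 'M[R]_N) : Prop :=
  symmx X /\ psd (Ymat x X) /\
  (forall i : 'I_m, (i < mI)%N -> frob (Qmat (cons i)) (Ymat x X) <= 0) /\
  (forall i : 'I_m, (mI <= i)%N -> frob (Qmat (cons i)) (Ymat x X) = 0).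

Definition D_SDP (x : 'rV[R]_N) (t : R) : Prop :=
  exists X : 'M[R]_N, sdp_feasible x X /\ frob (Qmat ord0) (Ymat x X) <= 2 * t.

Definition conv (S : 'rV[R]_N -> R -> Prop) (x : 'rV[R]_N) (t : R) : Prop :=
  exists (k : nat) (xs : 'I_k -> 'rV[R]_N) (ts : 'I_k -> R) (lam : 'I_k -> R),
    (forall j, S (xs j) (ts j)) /\ (forall j, 0 <= lam j) /\
    \sum_(j < k) lam j = 1 /\
    x = \sum_(j < k) lam j *: xs j /\ t = \sum_(j < k) lam j * ts j.

(* infimum comparison: two subsets of R have the same infimum (in the extended
   reals) iff they have the same set of lower bounds *)
Definition lower_bound (S : R -> Prop) (r : R) : Prop := forall y, S y -> r <= y.
Definition same_inf (S1 S2 : R -> Prop) : Prop :=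
  forall r, lower_bound S1 r <-> lower_bound S2 r.

Definition Opt_values (v : R) : Prop := exists x, feasible x /\ v = q ord0 x.
Definition OptSDP_values (v : R) : Prop :=
  exists x X, sdp_feasible x X /\ v = frob (Qmat ord0) (Ymat x X).

Definition Agam (g : 'rV[R]_m) : 'M[R]_N := A ord0 + \sum_(i < m) g 0 i *: A (cons i).
Definition bgam (g : 'rV[R]_m) : 'rV[R]_N := b ord0 + \sum_(i < m) g 0 i *: b (cons i).

Definition Gamma (g : 'rV[R]_m) : Prop :=
  psd (Agam g) /\ forall i : 'I_m, (i < mI)%N -> 0 <= g 0 i.

Definition assumptionA : Prop :=
  (exists x, feasible x) /\
  exists g : 'rV[R]_m, (forall i : 'I_m, (i < mI)%N -> 0 <= g 0 i) /\ pd (Agam g).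

Definition assumptionC : Prop :=
  exists (k : nat) (C : 'M[R]_(m, k)) (d : 'rV[R]_k),
    forall g, Gamma g <-> forall j : 'I_k, (g *m C) 0 j <= d 0 j.

End QCQP.

Section Geom.
Variable R : realFieldType.

Definition convex_set n (S : 'rV[R]_n -> Prop) : Prop :=
  forall x y (l : R), S x -> S y -> 0 <= l <= 1 -> S (l *: x + (1 - l) *: y).

Definition face n (K F : 'rV[R]_n -> Prop) : Prop :=
  (forall x, F x -> K x) /\ convex_set F /\
  forall x y (l : R), K x -> K y -> 0 < l < 1 -> F (l *: x + (1 - l) *: y) -> F x /\ F y.

Definition span n (S : 'rV[R]_n -> Prop) (v : 'rV[R]_n) : Prop :=
  exists (k : nat) (vs : 'I_k -> 'rV[R]_n) (a : 'I_k -> R),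
    (forall j, S (vs j)) /\ v = \sum_(j < k) a j *: vs j.

Definition is_dim n (S : 'rV[R]_n -> Prop) (d : nat) : Prop :=
  exists M : 'M[R]_n, (forall v, S v <-> (v <= M)%MS) /\ \rank M = d.

(* affine hull of a nonempty set S has dimension d:
   aff(S) = s0 + span {s - s0 : s in S} for any s0 in S *)
Definition is_affdim n (S : 'rV[R]_n -> Prop) (d : nat) : Prop :=
  exists s0, S s0 /\ is_dim (span (fun v => exists s, S s /\ v = s - s0)) d.
End Geom.

Section Faces.
Variables (R : realFieldType) (N mI mE : nat).
Local Notation m := (mI + mE)%N.
Variables (A : 'I_m.+1 -> 'M[R]_N) (b : 'I_m.+1 -> 'rV[R]_N).

Definition Gam := Gamma A.

Definition nonempty_face (F : 'rV[R]_m -> Prop) : Prop :=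
  face Gam F /\ exists g, F g.

Definition definite_face (F : 'rV[R]_m -> Prop) : Prop :=
  nonempty_face F /\ exists g, F g /\ pd (Agam A g).

Definition semidefinite_face (F : 'rV[R]_m -> Prop) : Prop :=
  nonempty_face F /\ ~ (exists g, F g /\ pd (Agam A g)).

Definition Vspace (F : 'rV[R]_m -> Prop) (v : 'rV[R]_N) : Prop :=
  forall g, F g -> Agam A g *m v^T = 0.

Definition bimage (F : 'rV[R]_m -> Prop) (w : 'rV[R]_N) : Prop :=
  exists g, F g /\ w = bgam b g.
End Faces.

(* Main.v *)
(** Weak duality bounds D_SDP by the set of (x, t) with q(gamma, x) <= 2 t on Gamma, since
    <A(gamma), X - x x^T> >= 0.  Conversely, for such a point with t minimal, the maximisers of
    q(., x) over Gamma form a face.  If the face is definite, first-order conditions put (x, t)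
    in D.  Otherwise the dimension hypothesis gives a nonzero v in V(F) on which b(gamma) is
    constant over F, so that (x, t) can be moved both ways along a line keeping F maximal;
    a positive definite A(gamma) makes the line leave the set on both sides, and at each exit
    point a new generator (point or ray) of the polyhedron Gamma becomes active.  Thus (x, t)
    is a convex combination of two points with more active generators. *)
Require Import Defs.
From HB Require Import structures.
From mathcomp Require Import all_boot all_order all_algebra.
From mathcomp Require Import ring lra.
From Stdlib Require Import Classical.
Set Implicit Arguments. Unset Strict Implicit. Unset Printing Implicit Defensive.
Import Order.TTheory GRing.Theory Num.Theory.
Local Open Scope ring_scope.

(** * Quadratic forms, definiteness and the Frobenius pairing *)

Section BilinearForms.
Variable R : realFieldType.
Implicit Type n : nat.

Lemma trmx00 n (M : 'M[R]_n.+1) : M 0 0 = M^T 0 0.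
Proof. by rewrite mxE. Qed.

Definition bf n (M : 'M[R]_n) (u v : 'rV[R]_n) : R := (u *m M *m v^T) 0 0.

Lemma bfDl n (M : 'M[R]_n) u u' v : bf M (u + u') v = bf M u v + bf M u' v.
Proof. by rewrite /bf !mulmxDl mxE. Qed.

Lemma bfDr n (M : 'M[R]_n) u v v' : bf M u (v + v') = bf M u v + bf M u v'.
Proof. by rewrite /bf linearD mulmxDr mxE. Qed.

Lemma bfZl n (M : 'M[R]_n) a u v : bf M (a *: u) v = a * bf M u v.
Proof. by rewrite /bf -!scalemxAl mxE. Qed.

Lemma bfZr n (M : 'M[R]_n) a u v : bf M u (a *: v) = a * bf M u v.
Proof. by rewrite /bf linearZ -scalemxAr mxE. Qed.

Lemma bf_addmx n (M M' : 'M[R]_n) u v : bf (M + M') u v = bf M u v + bf M' u v.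
Proof. by rewrite /bf mulmxDr mulmxDl mxE. Qed.

Lemma bf_scalemx n a (M : 'M[R]_n) u v : bf (a *: M) u v = a * bf M u v.
Proof. by rewrite /bf -scalemxAr -scalemxAl mxE. Qed.

Lemma bf_summx n (I : finType) (a : I -> R) (M : I -> 'M[R]_n) u v :
  bf (\sum_i a i *: M i) u v = \sum_i a i * bf (M i) u v.
Proof.
rewrite /bf mulmx_sumr mulmx_suml summxE; apply: eq_bigr => i _.
by rewrite -scalemxAr -scalemxAl mxE.
Qed.

Lemma bfC n (M : 'M[R]_n) u v : symmx M -> bf M u v = bf M v u.
Proof.
move=> sM; rewrite /bf trmx00.
have -> : (u *m M *m v^T)^T = v *m M *m u^T by rewrite !trmx_mul trmxK sM mulmxA.
by [].
Qed.

Lemma bf_sum_entries n (M : 'M[R]_n) u v :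
  bf M u v = \sum_j \sum_i u 0 i * M i j * v 0 j.
Proof.
rewrite /bf mxE; apply: eq_bigr => j _.
by rewrite !mxE mulr_suml.
Qed.

Lemma bf_delta n (M : 'M[R]_n) u i : bf M u (delta_mx 0 i) = (u *m M) 0 i.
Proof. by rewrite /bf trmx_delta -colE mxE. Qed.

Lemma bf_delta2 n (M : 'M[R]_n) i j : bf M (delta_mx 0 i) (delta_mx 0 j) = M i j.
Proof. by rewrite bf_delta -rowE mxE. Qed.

Lemma bf_outer n (x w : 'rV[R]_n) : bf (x^T *m x) w w = ((w *m x^T) 0 0) ^+ 2.
Proof.
rewrite /bf mulmxA -mulmxA mxE big_ord_recl big_ord0 addr0 expr2; congr (_ * _).
by rewrite -[x *m w^T]trmxK trmx_mul trmxK mxE.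
Qed.

Lemma psd_ge0 n (M : 'M[R]_n) v : psd M -> 0 <= bf M v v.
Proof. by case=> _; apply. Qed.

Lemma pd_psd n (M : 'M[R]_n) : pd M -> psd M.
Proof.
case=> sM pM; split=> // v; have [->|v0] := eqVneq v 0; last exact/ltW/pM.
by rewrite !mul0mx mxE.
Qed.

(** The form is nonnegative at every [a *: u + c *: v], and a suitable choice of [a] and [c] gives
    the inequality, also when the form is degenerate. *)
Lemma psd_CS n (M : 'M[R]_n) u v : psd M -> bf M u v ^+ 2 <= bf M u u * bf M v v.
Proof.
move=> pM; have [sM _] := pM.
have H a c : 0 <= a ^+ 2 * bf M u u + 2 * a * c * bf M u v + c ^+ 2 * bf M v v.
  have := psd_ge0 (a *: u + c *: v) pM.
  rewrite !(bfDl, bfDr, bfZl, bfZr) (bfC v u sM).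
  by congr (_ <= _); ring.
have uu := psd_ge0 u pM; have := psd_ge0 v pM; rewrite le_eqVlt => /orP[/eqP vv0|vv].
  have [->|uv0] := eqVneq (bf M u v) 0; first by rewrite expr0n -vv0 mulr0.
  (* When [bf M v v = 0] the expression is affine in the second coefficient, and this choice would
     make it equal to -1. *)
  have := H 1 (- (bf M u u + 1) / (2 * bf M u v)); rewrite -vv0.
  have -> : 1 ^+ 2 * bf M u u + 2 * 1 * (- (bf M u u + 1) / (2 * bf M u v)) * bf M u v +
     (- (bf M u u + 1) / (2 * bf M u v)) ^+ 2 * 0 = -1 by field.
  by rewrite oppr_ge0 ler10.
have := H (bf M v v) (- bf M u v).
have -> : bf M v v ^+ 2 * bf M u u + 2 * bf M v v * - bf M u v * bf M u v +
   (- bf M u v) ^+ 2 * bf M v v = bf M v v * (bf M u u * bf M v v - bf M u v ^+ 2) by ring.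
by rewrite pmulr_rge0 // subr_ge0.
Qed.

Lemma pd_unit n (M : 'M[R]_n) : pd M -> M \in unitmx.
Proof.
case=> _ pM; rewrite -row_free_unit -kermx_eq0; apply/eqP/row_matrixP => i.
rewrite row0; apply/eqP/negPn/negP => ki0.
have := pM _ ki0; rewrite -row_mul mulmx_ker row0 mul0mx mxE.
by rewrite ltxx.
Qed.

(* Cauchy-Schwarz against the vector z with z M = e_i bounds v_i^2 by (z M z) (v M v). *)
Lemma pd_coord_bound n (M : 'M[R]_n) i : pd M ->
  exists2 K, 0 <= K & forall v : 'rV_n, v 0 i ^+ 2 <= K * bf M v v.
Proof.
move=> pM; have uM := pd_unit pM; have psM := pd_psd pM; have [sM _] := pM.
pose z := delta_mx 0 i *m invmx M : 'rV[R]_n.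
exists (bf M z z) => [|v]; first exact: psd_ge0.
have -> : v 0 i = bf M z v.
  by rewrite /bf /z mulmxKV // -rowE !mxE.
exact: psd_CS.
Qed.

(** Replaces compactness of the unit sphere: [|v_i v_j| <= v_i^2 + v_j^2], and each square is at
    most a multiple of [bf M v v]. *)
Lemma pd_dominates n (M B : 'M[R]_n) : pd M ->
  exists2 K, 0 <= K & forall v, `|bf B v v| <= K * bf M v v.
Proof.
move=> pM.
have /fin_all_exists [K HK] : forall i : 'I_n,
    exists K, 0 <= K /\ forall v : 'rV_n, v 0 i ^+ 2 <= K * bf M v v.
  by move=> i; have [K ? ?] := pd_coord_bound i pM; exists K.
exists (\sum_j \sum_i `|B i j| * (K i + K j)).
  by do 2!(apply: sumr_ge0 => ? _); rewrite mulr_ge0 ?addr_ge0 //; apply (HK _).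
move=> v; rewrite bf_sum_entries (le_trans (ler_norm_sum _ _ _)) // mulr_suml ler_sum // => j _.
rewrite (le_trans (ler_norm_sum _ _ _)) // mulr_suml ler_sum // => i _.
rewrite mulrAC [v 0 i * _ * _]mulrC normrM -mulrA ler_wpM2l //.
have := (HK i).2 v; have := (HK j).2 v; rewrite mulrDl ler_norml.
have := sqr_ge0 (v 0 i + v 0 j); have := sqr_ge0 (v 0 i - v 0 j).
have := sqr_ge0 (v 0 i); have := sqr_ge0 (v 0 j).
by move=> *; apply/andP; split; nra.
Qed.

(** If [|bf B v v| <= K * bf M v v], a perturbation of size at most [1 / (K + 1)] keeps the form
    nonnegative; the [+ 1] covers [K = 0]. *)
Lemma pd_perturb n (M B : 'M[R]_n) : pd M -> symmx B ->
  exists2 e, 0 < e & forall d, `|d| <= e -> psd (M + d *: B).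
Proof.
move=> pM sB; have [K K0 HK] := pd_dominates B pM; have [sM _] := pM.
have K1 : 0 < K + 1 by lra.
exists (K + 1)^-1; rewrite ?invr_gt0 // => d hd; split.
  by rewrite /symmx linearD linearZ /= sM sB.
move=> v; rewrite -/(bf _ _ _) bf_addmx bf_scalemx.
have /ler_normlP[h1 h2] : `|d * bf B v v| <= bf M v v; last lra.
have M0 := psd_ge0 v (pd_psd pM).
rewrite normrM (le_trans (ler_pM _ _ hd (HK v))) // ler_pdivrMl //.
by nra.
Qed.

Lemma frobD n (P Y Z : 'M[R]_n) : frob P (Y + Z) = frob P Y + frob P Z.
Proof.
rewrite /frob -big_split; apply: eq_bigr => i _ /=; rewrite -big_split.
by apply: eq_bigr => j _ /=; rewrite mxE mulrDr.
Qed.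

Lemma frobZ n (P Y : 'M[R]_n) a : frob P (a *: Y) = a * frob P Y.
Proof.
rewrite /frob mulr_sumr; apply: eq_bigr => i _; rewrite mulr_sumr.
by apply: eq_bigr => j _; rewrite mxE mulrCA.
Qed.

Lemma frobC n (P Y : 'M[R]_n) : frob P Y = frob Y P.
Proof. by apply: eq_bigr => i _; apply: eq_bigr => j _; rewrite mulrC. Qed.

Lemma frob0 n (P : 'M[R]_n) : frob P 0 = 0.
Proof. by rewrite -(scale0r P) frobZ mul0r. Qed.

Lemma frob_sum n (P : 'M[R]_n) (I : finType) (Y : I -> 'M[R]_n) :
  frob P (\sum_i Y i) = \sum_i frob P (Y i).
Proof. by apply: (big_morph (frob P)); [exact: frobD|exact: frob0]. Qed.

Lemma frob_outer n (P : 'M[R]_n) (x : 'rV_n) : frob P (x^T *m x) = bf P x x.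
Proof.
rewrite bf_sum_entries exchange_big; apply: eq_bigr => i _; apply: eq_bigr => j _ /=.
rewrite mxE big_ord_recl big_ord0 addr0 !mxE; ring.
Qed.

Lemma psd_diag0 n (Y : 'M[R]_n) i : psd Y -> Y i i = 0 -> forall j, Y i j = 0.
Proof.
move=> pY Yi j; have := psd_CS (delta_mx 0 i) (delta_mx 0 j) pY.
rewrite !bf_delta2 Yi mul0r => h; apply/eqP; rewrite -sqrf_eq0 eq_le h sqr_ge0 //.
Qed.

(* Eliminating one nonzero diagonal entry of Y at a time by a Schur complement writes Y
   as a sum of positive multiples of rank-one matrices. *)
Lemma frob_psd_ge0 n (P Y : 'M[R]_n) : psd P -> psd Y -> 0 <= frob P Y.
Proof.
move=> pP; have [k] := ubnP #|[set i | Y i i != 0]|.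
elim: k Y => // k IH Y; rewrite ltnS => hk pY; have [sY _] := pY.
have [i Yi|H] := pickP (fun i => Y i i != 0); last first.
  suff -> : Y = 0 by rewrite frob0.
  by apply/matrixP=> i j; rewrite mxE psd_diag0 //; apply/eqP/negPn/negPf/H.
pose r := row i Y; pose Z := Y - (Y i i)^-1 *: (r^T *m r).
have Yii : 0 < Y i i.
  by rewrite lt_def Yi -bf_delta2; apply: psd_ge0.
have rr (j l : 'I_n) : (r^T *m r) j l = Y i j * Y i l.
  by rewrite mxE big_ord_recl big_ord0 addr0 !mxE.
have Zjj j : Z j j = Y j j - (Y i i)^-1 * (Y i j * Y i j).
  by rewrite -rr /Z; move: (r^T *m r) => B; rewrite !mxE.
have pZ : psd Z.
  split; first by rewrite /symmx /Z linearB linearZ /= trmx_mul trmxK sY.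
  move=> v; rewrite -/(bf _ _ _) /Z bf_addmx -scaleNr bf_scalemx bf_outer.
  have -> : (v *m r^T) 0 0 = bf Y v (delta_mx 0 i).
    by rewrite bf_delta /r tr_row sY colE mulmxA -colE mxE.
  have := psd_CS v (delta_mx 0 i) pY; rewrite bf_delta2.
  by rewrite mulNr subr_ge0 ler_pdivrMl // mulrC.
have -> : Y = Z + (Y i i)^-1 *: (r^T *m r) by rewrite subrK.
rewrite frobD frobZ frob_outer addr_ge0 ?mulr_ge0 ?invr_ge0 ?(ltW Yii) ?psd_ge0 //.
(* The number of nonzero diagonal entries drops: entry [i] becomes zero, and a zero diagonal entry
   of [Y] stays zero because its whole row vanishes. *)
apply: IH => //; apply: leq_trans hk; apply: proper_card.
apply/properP; split; last first.
  by exists i; rewrite !inE // negbK Zjj; apply/eqP; field.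
apply/subsetP=> j; rewrite !inE; apply: contraNneq => Yj.
have Yij : Y i j = 0 by rewrite -sY mxE psd_diag0.
by rewrite Zjj Yj Yij mulr0 mulr0 subr0.
Qed.

End BilinearForms.

(** * Polyhedral cones are finitely generated *)

Section Polyhedra.
Variable R : realFieldType.

Definition dot n (u v : 'rV[R]_n) : R := (u *m v^T) 0 0.

Lemma dotDl n (u u' v : 'rV[R]_n) : dot (u + u') v = dot u v + dot u' v.
Proof. by rewrite /dot mulmxDl mxE. Qed.

Lemma dotZl n a (u v : 'rV[R]_n) : dot (a *: u) v = a * dot u v.
Proof. by rewrite /dot -scalemxAl mxE. Qed.

Lemma dot0l n (v : 'rV[R]_n) : dot 0 v = 0.
Proof. by rewrite /dot mul0mx mxE. Qed.

Lemma dotC n (u v : 'rV[R]_n) : dot u v = dot v u.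
Proof. by rewrite /dot trmx00 trmx_mul trmxK. Qed.

Lemma dotDr n (u v v' : 'rV[R]_n) : dot u (v + v') = dot u v + dot u v'.
Proof. by rewrite dotC dotDl !(dotC u). Qed.

Lemma dotZr n a (u v : 'rV[R]_n) : dot u (a *: v) = a * dot u v.
Proof. by rewrite dotC dotZl (dotC u). Qed.

Lemma dot_suml n (I : finType) (F : I -> 'rV[R]_n) v :
  dot (\sum_i F i) v = \sum_i dot (F i) v.
Proof. exact: (big_morph (fun u => dot u v) (fun u u' => dotDl u u' v) (dot0l v)). Qed.

Lemma dot_sumE n (u v : 'rV[R]_n) : dot u v = \sum_i u 0 i * v 0 i.
Proof. by rewrite /dot mxE; apply: eq_bigr => i _; rewrite mxE. Qed.

Definition fgcone n (I : finType) (g : I -> 'rV[R]_n) (y : 'rV[R]_n) : Prop :=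
  exists2 l : I -> R, (forall i, 0 <= l i) & y = \sum_i l i *: g i.

Lemma fgcone_full n : exists (I : finType) (g : I -> 'rV[R]_n), forall y, fgcone g y.
Proof.
exists ('I_n + 'I_n)%type.
exists (fun i => match i with inl i => delta_mx 0 i | inr i => - delta_mx 0 i end) => y.
exists (fun i => match i with inl i => Num.max (y 0 i) 0 | inr i => Num.max (- y 0 i) 0 end).
  by case=> i; rewrite le_max lexx orbT.
rewrite big_sumType /= -big_split /= [LHS]row_sum_delta; apply: eq_bigr => i _.
rewrite scalerN -scalerBl; congr (_ *: _).
by case: (lerP (y 0 i) 0) => ?; case: (lerP (- y 0 i) 0) => ?; lra.
Qed.

(* One step of the double description method. *)
Lemma fgcone_halfspace n (I : finType) (g : I -> 'rV[R]_n) (c : 'rV[R]_n) :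
  exists (J : finType) (h : J -> 'rV[R]_n),
    forall y, (fgcone g y /\ dot y c <= 0) <-> fgcone h y.
Proof.
pose a i := dot (g i) c.
exists (I + I * I)%type.
(* Generators with [a i <= 0] are kept, and each pair strictly on opposite sides yields a positive
   combination on the hyperplane; the remaining indices carry 0. *)
pose h (k : I + I * I) := match k with
  | inl i => if a i <= 0 then g i else 0
  | inr (i, j) => if (0 < a i) && (a j < 0) then (- a j) *: g i + a i *: g j else 0 end.
exists h => y; split; last first.
  case=> l l0 ->; split.
    have cone0 : fgcone g 0.
      by exists (fun=> 0) => //; rewrite big1 // => i _; rewrite scale0r.
    have coneD u v : fgcone g u -> fgcone g v -> fgcone g (u + v).
      case=> lu hu -> [lv hv ->]; exists (fun i => lu i + lv i); first by move=> i; rewrite addr_ge0.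
      by rewrite -big_split; apply: eq_bigr => i _; rewrite scalerDl.
    have coneZ r u : 0 <= r -> fgcone g u -> fgcone g (r *: u).
      move=> r0 [lu hu ->]; exists (fun i => r * lu i); first by move=> i; rewrite mulr_ge0.
      by rewrite scaler_sumr; apply: eq_bigr => i _; rewrite scalerA.
    have coneg i : fgcone g (g i).
      exists (fun k => (k == i)%:R) => [k|]; first exact: ler0n.
      rewrite (bigD1 i) //= eqxx scale1r big1 ?addr0 // => k /negPf ->.
      by rewrite scale0r.
    apply: (big_ind (fgcone g)); [exact: cone0|exact: coneD|move=> k _].
    apply: (coneZ) => //; case: k => [i|[i j]] /=.
      by case: ifP.
    by case: ifP => // /andP[ai aj]; apply: coneD; apply: coneZ => //; lra.
  rewrite dot_suml; apply: sumr_le0 => k _; rewrite dotZl mulr_ge0_le0 //.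
  case: k => [i|[i j]] /=; first by case: ifP; rewrite ?dot0l.
  case: ifP; rewrite ?dot0l // dotDl !dotZl -!/(a _) => _.
  by rewrite mulNr mulrC addNr.
case=> -[l l0 ->]; rewrite dot_suml => hle.
(* The total masses of [y] on the two open sides; the constraint on [y] says [s <= t]. *)
pose s := \sum_(i | 0 < a i) l i * a i; pose t := \sum_(i | a i < 0) l i * - a i.
have s0 : 0 <= s by apply: sumr_ge0 => i /ltW ai; rewrite mulr_ge0.
have st : s <= t.
  move: hle; rewrite (eq_bigr (fun i => l i * a i)) => [|i _]; last by rewrite dotZl.
  rewrite (bigID (fun i => 0 < a i)) /= -/s (bigID (fun i => a i < 0)) /=.
  rewrite [X in _ + (_ + X)]big1 ?addr0 => [|i]; last first.
    by rewrite -!leNgt => /le_anti ->; rewrite mulr0.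
  rewrite (eq_bigl (fun i => a i < 0)) => [|i]; last by rewrite -leNgt andb_idl // => /ltW.
  have -> : \sum_(i | a i < 0) l i * a i = - t.
    by rewrite /t -sumrN; apply: eq_bigr => i _; rewrite mulrN opprK.
  by rewrite subr_le0.
(* [t / t] is 0 when [t = 0], but then [s <= t] forces [l i = 0] whenever [0 < a i]. *)
have lp i : 0 < a i -> l i * (t / t) = l i.
  move=> ai; have [t0|t0] := eqVneq t 0; last by rewrite divff ?mulr1.
  have : l i * a i <= 0.
    have : s <= 0 by lra.
    rewrite /s (bigD1 i) //=; have : 0 <= \sum_(j | (0 < a j) && (j != i)) l j * a j.
      by apply: sumr_ge0 => j /andP[/ltW aj _]; rewrite mulr_ge0.
    lra.
  rewrite pmulr_lle0 // => li; have -> : l i = 0 by apply/eqP; rewrite eq_le li l0.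
  by rewrite mul0r.
(* Each [g i] with [0 < a i] is paired with all negative generators in proportion to their mass;
   this uses up the fraction [s / t] of every negative one. *)
exists (fun k => match k with
  | inl i => if a i < 0 then (1 - s / t) * l i else l i
  | inr (i, j) => l i * l j / t end).
  have t0 : 0 <= t by lra.
  case=> [i|[i j]]; last by rewrite !mulr_ge0 ?invr_ge0.
  case: ifP => // _; rewrite mulr_ge0 // subr_ge0.
  by have [->|tn0] := eqVneq t 0; rewrite ?invr0 ?mulr0 // ler_pdivrMr ?mul1r // lt_def tn0.
rewrite big_sumType /=.
have -> : \sum_(p : I * I) (let (i, j) := p in l i * l j / t) *: h (inr p) =
   \sum_(i | 0 < a i) l i *: g i + (s / t) *: \sum_(j | a j < 0) l j *: g j.
  transitivity (\sum_i \sum_j (l i * l j / t) *: h (inr (i, j))).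
    by rewrite pair_big; apply: eq_bigr => -[i j].
  transitivity (\sum_(i | 0 < a i) \sum_(j | a j < 0)
     ((l i * (l j * - a j / t)) *: g i + (l i * a i / t) *: (l j *: g j))).
    rewrite [RHS]big_mkcond; apply: eq_bigr => i _ /=; case: ifP => ai; last first.
      by rewrite big1 // => j _; rewrite scaler0.
    rewrite [RHS]big_mkcond; apply: eq_bigr => j _ /=; case: ifP => aj; last by rewrite scaler0.
    by rewrite scalerDr !scalerA; congr (_ *: _ + _ *: _); ring.
  under eq_bigr do rewrite big_split /= -scaler_suml -scaler_sumr.
  rewrite big_split /= -scaler_suml; congr (_ + _ *: _); last by rewrite mulr_suml.
  apply: eq_bigr => i ai; rewrite -mulr_sumr -mulr_suml -/t lp //.
rewrite addrCA (bigID (fun i => 0 < a i)) /=; congr (_ + _).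
rewrite scaler_sumr big_mkcond [X in _ + X]big_mkcond -big_split; apply: eq_bigr => i _ /=.
rewrite -leNgt; case: (ltrgt0P (a i)) => ai; rewrite ?scaler0 ?addr0 //.
by rewrite scalerA -scalerDl; congr (_ *: _); ring.
Qed.

(** The constraints-to-generators half of the Minkowski-Weyl theorem: the whole space is cut by one
    half-space at a time. *)
Lemma polyhedral_cone_fg n (cs : seq 'rV[R]_n) :
  exists (I : finType) (g : I -> 'rV[R]_n),
    forall y, (forall c, c \in cs -> dot y c <= 0) <-> fgcone g y.
Proof.
elim: cs => [|c cs [I [g IH]]].
  by have [I [g H]] := fgcone_full n; exists I, g => y; split.
have [J [h H]] := fgcone_halfspace g c; exists J, h => y; rewrite -H -IH; split.
  by move=> hy; split=> [d hd|]; apply: hy; rewrite inE ?hd ?eqxx ?orbT.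
by case=> h1 h2 d; rewrite inE => /orP[/eqP ->|/h1].
Qed.

End Polyhedra.

(** * Dimension of subspaces given as predicates, and orthogonal vectors *)

Section Subspaces.
Variables (R : realFieldType) (n : nat).

(** A basis is found classically: as long as the row space of [M] misses a vector of [S], adjoining
    it raises the rank, which cannot exceed [n]. *)
Lemma is_dim_exists (S : 'rV[R]_n -> Prop) :
  S 0 -> (forall a u v, S u -> S v -> S (a *: u + v)) -> exists d, is_dim S d.
Proof.
move=> S0 Slin.
have Ssum (M : 'M[R]_n) : (forall i, S (row i M)) -> forall v, (v <= M)%MS -> S v.
  move=> HM v /submxP[w ->]; rewrite mulmx_sum_row.
  by apply: (big_ind S) => // [u u' ? ?|i _]; [rewrite -(scale1r u)|rewrite -[_ *: _]addr0]; apply: Slin.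
have [k] : exists k, exists M : 'M[R]_n, (forall v, (v <= M)%MS -> S v) /\ (n <= \rank M + k)%N.
  exists n, 0; split=> [v|]; last by rewrite leq_addl.
  by rewrite submx0 => /eqP ->.
elim: k => [|k IH] [M [HM hr]].
  exists (\rank M), M; split=> // v; split=> [_|]; last exact: HM.
  by rewrite submx_full // /row_full eqn_leq rank_leq_col -[X in (n <= X)%N]addn0.
case: (classic (exists v, S v /\ ~~ (v <= M)%MS)) => [[v [Sv vM]]|H]; last first.
  exists (\rank M), M; split=> // v; split=> [Sv|]; last exact: HM.
  by apply/negPn/negP => vM; apply: H; exists v.
apply: IH; exists (v + M)%MS; split.
  move=> w /sub_addsmxP[[a b] /= ->]; rewrite [a]mx11_scalar mul_scalar_mx.
  by apply: Slin => //; apply: HM; rewrite submxMl.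
have : (M < v + M)%MS by rewrite /ltmx addsmxSr /= addsmx_sub negb_and vM.
by move/rank_ltmx => lt; apply: leq_trans hr _; rewrite addnS -addSn leq_add2r.
Qed.

(** [row_base V *m W^T] has [\rank V] rows but rank at most [\rank W], so its left kernel is
    nonzero; kernel vectors are coordinates, in the basis of [V], of vectors orthogonal to [W]. *)
Lemma exists_orthogonal (V W : 'M[R]_n) : (\rank W < \rank V)%N ->
  exists2 v : 'rV[R]_n, v != 0 & (v <= V)%MS /\ forall w : 'rV_n, (w <= W)%MS -> dot w v = 0.
Proof.
move=> lt; set K := kermx (row_base V *m W^T).
have K0 : K != 0.
  rewrite -mxrank_eq0 mxrank_ker subn_eq0 -ltnNge (leq_ltn_trans (mxrankM_maxr _ _)) //.
  by rewrite mxrank_tr.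
have [i Ki] : exists i, row i K != 0.
  apply: NNPP => H; move/eqP: K0; apply; apply/row_matrixP => i; rewrite row0.
  by apply/eqP/negPn/negP => Ki; apply: H; exists i.
exists (row i K *m row_base V).
  by rewrite -(mul0mx _ (row_base V)); apply: contra_neq Ki => /(row_free_inj (row_base_free V)).
split; first by rewrite -(eq_row_base V) submxMl.
move=> w /submxP[u ->]; rewrite dotC /dot trmx_mul mulmxA -[_ *m W^T]mulmxA -row_mul mulmx_ker.
by rewrite row0 mul0mx mxE.
Qed.

End Subspaces.

(** * Points and rays generating a polyhedron, by homogenisation *)

Section Generators.
Variable R : realFieldType.

(** Homogeneous coordinates with the height [s] in position 0: points of a polyhedron sit at height
    1, recession directions at height 0. *)
Definition homog n (s : R) (g : 'rV[R]_n) : 'rV[R]_n.+1 :=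
  \row_j oapp (g 0) s (unlift ord0 j).

Lemma homog0 n s (g : 'rV[R]_n) : homog s g 0 ord0 = s.
Proof. by rewrite mxE unlift_none. Qed.

Lemma homogS n s (g : 'rV[R]_n) i : homog s g 0 (lift ord0 i) = g 0 i.
Proof. by rewrite mxE liftK. Qed.

Lemma homog_onto n (y : 'rV[R]_n.+1) : y = homog (y 0 ord0) (\row_i y 0 (lift ord0 i)).
Proof.
apply/rowP=> j; case: (unliftP ord0 j) => [i ->|->]; last by rewrite homog0.
by rewrite homogS mxE.
Qed.

Lemma dot_homog n s s' (g g' : 'rV[R]_n) : dot (homog s g) (homog s' g') = s * s' + dot g g'.
Proof.
rewrite !dot_sumE big_ord_recl !homog0; congr (_ + _).
by apply: eq_bigr => i _; rewrite !homogS.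
Qed.

(* Finite generation of the cone {(s, g) : s >= 0, g C <= s d} over the polyhedron. *)
Lemma polyhedron_generators n k (C : 'M[R]_(n, k)) (d : 'rV[R]_k) (P : 'rV[R]_n -> Prop) :
  (forall g, P g <-> forall j, (g *m C) 0 j <= d 0 j) ->
  exists (I : finType) (s : I -> R) (h : I -> 'rV[R]_n),
  [/\ forall g, P g -> exists l : I -> R,
        [/\ forall i, 0 <= l i, \sum_i l i * s i = 1 & g = \sum_i l i *: h i],
      forall i, 0 <= s i,
      forall i, 0 < s i -> P ((s i)^-1 *: h i) &
      forall i, s i = 0 -> forall g r, P g -> 0 <= r -> P (g + r *: h i)].
Proof.
(* The first vector encodes [0 <= s], the others [(g *m C) 0 j <= s * d 0 j]. *)
move=> PE; pose cs := homog (-1) 0 :: [seq homog (- d 0 j) (col j C)^T | j <- enum 'I_k].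
have dC g j : dot g (col j C)^T = (g *m C) 0 j.
  by rewrite dot_sumE mxE; apply: eq_bigr => i _; rewrite !mxE.
have csE s g : (forall c, c \in cs -> dot (homog s g) c <= 0) <->
    0 <= s /\ forall j, (g *m C) 0 j <= s * d 0 j.
  split=> [H|[s0 H] c].
    split=> [|j].
      have := H _ (mem_head _ _); rewrite dot_homog dotC dot0l; lra.
    have /H : homog (- d 0 j) (col j C)^T \in cs.
      by rewrite inE; apply/orP; right; apply/mapP; exists j; rewrite ?mem_enum.
    rewrite dot_homog dC; lra.
  rewrite inE => /orP[/eqP ->|/mapP[j _ ->]]; rewrite dot_homog ?dC.
    by rewrite dotC dot0l; lra.
  by have := H j; lra.
have [I [y Hy]] := polyhedral_cone_fg cs.
exists I, (fun i => y i 0 ord0), (fun i => \row_j y i 0 (lift ord0 j)).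
have yc i : 0 <= y i 0 ord0 /\
    forall j, ((\row_l y i 0 (lift ord0 l)) *m C) 0 j <= y i 0 ord0 * d 0 j.
  apply/csE; rewrite -homog_onto; apply/Hy.
  exists (fun k => (k == i)%:R) => [j|]; first exact: ler0n.
  rewrite (bigD1 i) //= eqxx scale1r big1 ?addr0 // => j /negPf ->.
  by rewrite scale0r.
split=> [g Pg|i|i s0|i s0 g r Pg r0]; first 1 last.
- exact: (yc i).1.
- apply/PE => j; rewrite -scalemxAl mxE ler_pdivrMl //; exact: (yc i).2.
- apply/PE => j; rewrite mulmxDl -scalemxAl; have := (yc i).2 j.
  rewrite s0 mul0r => h; have /PE/(_ j) := Pg; move: h.
  by move: (_ *m C) (g *m C) => u v; rewrite !mxE; nra.
have : forall c, c \in cs -> dot (homog 1 g) c <= 0.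
  by apply/csE; split=> // j; rewrite mul1r; apply/PE: j.
move/Hy => [l l0 E]; exists l; split=> //.
  have := homog0 1 g; rewrite E summxE => <-; apply: eq_bigr => i _.
  by rewrite mxE.
apply/rowP=> j; rewrite -(homogS 1) E !summxE; apply: eq_bigr => i _.
by rewrite !mxE.
Qed.

End Generators.

(** * Signs of finitely many one-variable quadratics *)

Section Quadratics.
Variable R : realFieldType.

(** Continuity with an explicit radius: the increment [h * (b + 2 * s * a + h * a)] is at most
    [|h| * K] when [|h| <= 1], hence at most [- p / 2] within the radius. *)
Lemma quad_neg_near (a b c s : R) : c + s * b + s ^+ 2 * a < 0 ->
  exists2 e, 0 < e & forall h, `|h| <= e -> c + (s + h) * b + (s + h) ^+ 2 * a < 0.
Proof.
set p := c + _ + _ => p0; set K := `|b + 2 * s * a| + `|a| + 1.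
have K0 : 0 < K by rewrite ltr_wpDl ?addr_ge0.
exists (Num.min 1 (- p / (2 * K))).
  by rewrite lt_min ltr01 divr_gt0 ?mulr_gt0 ?oppr_gt0.
move=> h; rewrite le_min => /andP[h1]; rewrite ler_pdivlMr ?mulr_gt0 // => h2.
have -> : c + (s + h) * b + (s + h) ^+ 2 * a = p + h * (b + 2 * s * a + h * a).
  by rewrite /p; ring.
have : h * (b + 2 * s * a + h * a) <= `|h| * K.
  apply: le_trans (ler_norm _) _; rewrite normrM ler_wpM2l //.
  apply: le_trans (ler_normD _ _) _; rewrite /K -addrA lerD2l normrM.
  have := normr_ge0 a; nra.
by nra.
Qed.

Lemma quad_bounded (a b c : R) : 0 < a ->
  exists B, forall s, c + s * b + s ^+ 2 * a <= 0 -> s <= B.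
Proof.
(* Beyond this bound [s * a] exceeds [|b| + |c|], and the [+ 1] ensures [1 < s], so the leading term
   beats the other two. *)
move=> a0; exists ((`|b| + `|c|) / a + 1) => s hs; rewrite leNgt; apply/negP => hB.
have h0 : 0 <= (`|b| + `|c|) / a by rewrite divr_ge0 ?addr_ge0 // ltW.
have s1 : 1 < s by lra.
have : `|b| + `|c| < s * a by rewrite -ltr_pdivrMr //; lra.
have := ler_norm (- b); have := ler_norm (- c); rewrite !normrN => hc hb h.
have h1 : s * (`|b| + `|c|) < s ^+ 2 * a by rewrite expr2 -mulrA ltr_pM2l //; lra.
have h2 : `|c| <= s * `|c| by rewrite ler_peMl // ltW.
have h3 : s * - b <= s * `|b| by rewrite ler_pM2l //; lra.
lra.
Qed.

(** The reciprocal of one plus the sum of the reciprocals is a bound that also makes sense for an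
    empty index type. *)
Lemma fin_pos_lb (I : finType) (e : I -> R) : (forall i, 0 < e i) ->
  exists2 d, 0 < d & forall i, d <= e i.
Proof.
move=> e0; have S0 : 0 <= \sum_i (e i)^-1 by apply: sumr_ge0 => i _; rewrite invr_ge0 ltW.
exists (1 + \sum_i (e i)^-1)^-1 => [|i]; first by rewrite invr_gt0; lra.
rewrite -[leRHS]invrK lef_pV2 ?posrE ?invr_gt0 //; last lra.
rewrite (bigD1 i) //=; have : 0 <= \sum_(j | j != i) (e j)^-1.
  by apply: sumr_ge0 => j _; rewrite invr_ge0 ltW.
lra.
Qed.

(** The parameter is the supremum of those at which all quadratics are nonpositive. There a
    quadratic with [c k < 0] must vanish, since otherwise the supremum could be exceeded. *)
Lemma quad_first_hit (I : finType) (a b c : I -> R) : complete_field R ->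
  (forall k, c k <= 0) -> (forall k, c k = 0 -> a k = 0 /\ b k = 0) ->
  (exists B, forall s, (forall k, c k + s * b k + s ^+ 2 * a k <= 0) -> s <= B) ->
  exists s, [/\ 0 < s, forall k, c k + s * b k + s ^+ 2 * a k <= 0 &
    exists k, c k < 0 /\ c k + s * b k + s ^+ 2 * a k = 0].
Proof.
move=> hR c0 hact [B hB].
pose ok s := forall k, c k + s * b k + s ^+ 2 * a k <= 0.
have [||s [ub lub]] := hR ok.
- by exists 0 => k; rewrite mul0r expr0n mul0r !addr0.
- by exists B.
have s0 : 0 <= s by apply: ub => k; rewrite mul0r expr0n mul0r !addr0.
have oks : ok s.
  (* A quadratic positive at [s] would be positive on [[s - e, s]], making [s - e] an upper
     bound. *)
  move=> k; rewrite leNgt; apply/negP => h.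
  have [|e e0 He] := @quad_neg_near (- a k) (- b k) (- c k) s.
    by rewrite !mulrN -!opprD oppr_lt0.
  suff : s <= s - e by lra.
  apply: lub => r okr; rewrite leNgt; apply/negP => hr.
  have rs := ub r okr; have := okr k; have := He (r - s).
  rewrite (addrC s) subrK ler_norml !mulrN -!opprD oppr_lt0 => hh.
  by rewrite leNgt hh //; apply/andP; split; lra.
have [hit|nohit] := classic (exists k, c k < 0 /\ c k + s * b k + s ^+ 2 * a k = 0).
  exists s; split=> //; rewrite lt_def s0 andbT; apply/negP => /eqP sz.
  by case: hit => k [ck]; rewrite sz mul0r expr0n mul0r !addr0 => h; lra.
(* Without a hit, each quadratic is identically zero or strictly negative at [s], so it stays
   nonpositive slightly beyond [s]. *)
have /fin_all_exists [e He] : forall k, exists e, 0 < e /\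
    forall h, `|h| <= e -> c k + (s + h) * b k + (s + h) ^+ 2 * a k <= 0.
  move=> k; have := c0 k; rewrite le_eqVlt => /orP[/eqP ck|ck].
    by have [-> ->] := hact _ ck; exists 1; split=> // h _; rewrite ck !mulr0 !addr0.
  have [|e e0 h] := @quad_neg_near (a k) (b k) (c k) s.
    rewrite lt_def oks andbT eq_sym; apply/negP => /eqP h; apply: nohit; by exists k.
  by exists e; split=> // r hr; apply/ltW/h.
have [d d0 hd] := fin_pos_lb (fun k => (He k).1).
suff : s + d <= s by lra.
by apply: ub => k; apply: (He k).2; rewrite gtr0_norm.
Qed.

End Quadratics.

(** * Closure properties of the convex hull *)

Section ConvexHull.
Variables (R : realFieldType) (n : nat).
Implicit Type S : 'rV[R]_n -> R -> Prop.

Lemma conv_incl S x t : S x t -> conv S x t.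
Proof.
move=> Sxt; exists 1%N, (fun=> x), (fun=> t), (fun=> 1).
by rewrite !big_ord1 scale1r mul1r; split=> //; split.
Qed.

Lemma conv_mix S x t y s p r : conv S x t -> conv S y s -> 0 <= p -> 0 <= r -> p + r = 1 ->
  conv S (p *: x + r *: y) (p * t + r * s).
Proof.
case=> k1 [x1 [t1 [l1 [S1 [l10 [s1 [-> ->]]]]]]].
case=> k2 [x2 [t2 [l2 [S2 [l20 [s2 [-> ->]]]]]]] p0 r0 pr.
pose glue T (f : 'I_k1 -> T) (g : 'I_k2 -> T) i := match split i with inl i => f i | inr i => g i end.
have gl T f g i : @glue T f g (lshift k2 i) = f i.
  by rewrite /glue; have := unsplitK (inl i : 'I_k1 + 'I_k2) => /= ->.
have gr T f g i : @glue T f g (rshift k1 i) = g i.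
  by rewrite /glue; have := unsplitK (inr i : 'I_k1 + 'I_k2) => /= ->.
exists (k1 + k2)%N, (glue _ x1 x2), (glue _ t1 t2), (glue _ (fun i => p * l1 i) (fun i => r * l2 i)).
split; first by move=> j; rewrite /glue; case: split.
split; first by move=> j; rewrite /glue; case: split => i; rewrite mulr_ge0.
rewrite !big_split_ord /=; split.
  under eq_bigr do rewrite gl.
  under [X in _ + X]eq_bigr do rewrite gr.
  by rewrite -!mulr_sumr s1 s2 !mulr1.
split.
  under [X in _ = X + _]eq_bigr do rewrite !gl -scalerA.
  under [X in _ = _ + X]eq_bigr do rewrite !gr -scalerA.
  by rewrite !scaler_sumr.
under [X in _ = X + _]eq_bigr do rewrite !gl -mulrA.
under [X in _ = _ + X]eq_bigr do rewrite !gr -mulrA.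
by rewrite !mulr_sumr.
Qed.

Lemma conv_raise S x t s : (forall y r r', S y r -> r <= r' -> S y r') ->
  conv S x t -> t <= s -> conv S x s.
Proof.
move=> Sup [k [xs [ts [l [HS [l0 [l1 [-> ->]]]]]]]] ts_le.
set u := \sum_j _ in ts_le.
exists k, xs, (fun j => ts j + (s - u)), l; do !split=> //.
  by move=> j; apply: Sup (HS j) _; rewrite lerDl subr_ge0.
under eq_bigr do rewrite mulrDr.
by rewrite big_split /= -mulr_suml l1 -/u; ring.
Qed.

End ConvexHull.

(** * The Lagrangian, its maximising faces, and the definite case *)

Section QCQPTheory.
Variables (R : realFieldType) (N mI mE : nat).
Local Notation m := (mI + mE)%N.
Variables (A : 'I_m.+1 -> 'M[R]_N) (b : 'I_m.+1 -> 'rV[R]_N) (c : 'I_m.+1 -> R).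
Hypothesis hsym : forall i, symmx (A i).

Local Notation qf := (q A b c).

(** The Lagrangian [q(gamma, x)]: affine in [g], and quadratic in [x] with coefficients [Agam A g]
    and [bgam b g]. *)
Definition qgam (g : 'rV[R]_m) (x : 'rV[R]_N) : R :=
  qf ord0 x + \sum_i g 0 i * qf (cons i) x.

Lemma Agam_sym g : symmx (Agam A g).
Proof.
rewrite /symmx /Agam linearD linear_sum /= hsym; congr (_ + _).
by apply: eq_bigr => i _; rewrite linearZ /= hsym.
Qed.

Lemma bf_Agam g u v : bf (Agam A g) u v = bf (A ord0) u v + \sum_i g 0 i * bf (A (cons i)) u v.
Proof. by rewrite bf_addmx bf_summx. Qed.

Lemma dot_bgam g v : dot (bgam b g) v = dot (b ord0) v + \sum_i g 0 i * dot (b (cons i)) v.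
Proof. by rewrite dotDl dot_suml; under eq_bigr do rewrite dotZl. Qed.

Lemma AgamD g h : Agam A (g + h) = Agam A g + \sum_i h 0 i *: A (cons i).
Proof.
rewrite /Agam -addrA -big_split; congr (_ + _); apply: eq_bigr => i _ /=.
by rewrite mxE scalerDl.
Qed.

Lemma Agam_comb (g h : 'rV[R]_m) (l : R) :
  Agam A (l *: g + (1 - l) *: h) = l *: Agam A g + (1 - l) *: Agam A h.
Proof.
rewrite /Agam !scalerDr addrACA -scalerDl (addrC l) subrK scale1r; congr (_ + _).
by rewrite !scaler_sumr -big_split; apply: eq_bigr => i _ /=; rewrite !mxE !scalerA -scalerDl.
Qed.

Lemma qgam_comb (g h : 'rV[R]_m) (l : R) x :
  qgam (l *: g + (1 - l) *: h) x = l * qgam g x + (1 - l) * qgam h x.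
Proof.
rewrite /qgam (mulrDr l) (mulrDr (1 - l)) addrACA -mulrDl (addrC l) subrK mul1r; congr (_ + _).
by rewrite !mulr_sumr -big_split; apply: eq_bigr => i _ /=; rewrite !mxE; ring.
Qed.

Lemma Gamma_convex : convex_set (Gamma A).
Proof.
move=> g h l [[_ pg] g0] [[_ ph] h0] /andP[l0 l1]; split=> [|i hi]; last first.
  by rewrite !mxE addr_ge0 ?mulr_ge0 ?g0 ?h0 ?subr_ge0.
split=> [|v]; first exact: Agam_sym.
rewrite -/(bf _ _ _) Agam_comb bf_addmx !bf_scalemx.
by rewrite addr_ge0 ?mulr_ge0 ?subr_ge0 //; [exact: pg|exact: ph].
Qed.

(** The derivative of the [i]-th quadratic at [x] along [v], for symmetric [A i]. *)
Definition qdir i (x v : 'rV[R]_N) : R := 2 * (bf (A i) x v + dot (b i) v).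

Lemma q_line i x v r :
  qf i (x + r *: v) = qf i x + r * qdir i x v + r ^+ 2 * bf (A i) v v.
Proof.
rewrite /q -!/(bf _ _ _) -!/(dot _ _) /qdir !(bfDl, bfDr, bfZl, bfZr, dotDr, dotZr).
by rewrite (bfC v x (hsym i)); ring.
Qed.

Lemma qgam_line g x v r : qgam g (x + r *: v) =
  qgam g x + r * (2 * (bf (Agam A g) x v + dot (bgam b g) v)) + r ^+ 2 * bf (Agam A g) v v.
Proof.
rewrite /qgam !bf_Agam dot_bgam q_line /qdir.
under eq_bigr do rewrite q_line /qdir.
rewrite (eq_bigr (fun i => g 0 i * qf (cons i) x +
  (2 * r * (g 0 i * bf (A (cons i)) x v) + 2 * r * (g 0 i * dot (b (cons i)) v)) +
  r ^+ 2 * (g 0 i * bf (A (cons i)) v v))); last by move=> i _; ring.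
by rewrite !big_split /= -!mulr_sumr; ring.
Qed.

(* A positive definite maximiser of g |-> q(g, x) over Gamma is in the relative interior of the
   semidefinite constraint, so the first-order conditions only see the sign constraints. *)
Lemma definite_max_in_D g x t : (forall h, Gamma A h -> qgam h x <= 2 * t) ->
  Gamma A g -> pd (Agam A g) -> qgam g x = 2 * t -> D A b c x t.
Proof.
move=> hS [psg g0] pg gt.
(* Changing only multiplier [i] by a small [d] stays in Gamma as long as its sign constraint holds,
   so maximality of [g] bounds the change of the Lagrangian. *)
have pert (i : 'I_m) : exists2 e, 0 < e & forall d, `|d| <= e -> ((i < mI)%N -> 0 <= g 0 i + d) ->
    d * qf (cons i) x <= 0.
  have [e e0 He] := pd_perturb pg (hsym (cons i)); exists e => // d de gd.
  have DE : \sum_j (d *: delta_mx 0 i : 'rV[R]_m) 0 j *: A (cons j) = d *: A (cons i).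
    rewrite (bigD1 i) //= big1 => [|j ji]; first by rewrite !mxE !eqxx mulr1 addr0.
    by rewrite !mxE (negPf ji) mulr0 scale0r.
  have /hS : Gamma A (g + d *: delta_mx 0 i).
    split=> [|j hj]; first by rewrite AgamD DE; apply: He.
    rewrite !mxE /=; have [E|ji] := eqVneq j i; rewrite ?mulr1 ?mulr0 ?addr0 ?g0 //.
    by move: hj; rewrite E.
  rewrite -gt /qgam; under eq_bigr do rewrite mxE mulrDl.
  rewrite big_split /= [X in _ + (_ + X)](bigD1 i) //= [X in _ + (_ + (_ + X))]big1 => [|j ji].
    by rewrite !mxE !eqxx mulr1; lra.
  by rewrite !mxE (negPf ji) mulr0 mul0r.
have le0 i : qf (cons i) x <= 0.
  have [e e0 He] := pert i; rewrite -(pmulr_rle0 _ e0); apply: He; first by rewrite gtr0_norm.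
  by move=> hi; rewrite addr_ge0 ?g0 // ltW.
(* A multiplier that is nonzero or belongs to an equality constraint can also be decreased, which
   gives the reverse inequality and then complementary slackness. *)
have ge0 (i : 'I_m) : (g 0 i != 0) || (mI <= i)%N -> 0 <= qf (cons i) x.
  move=> hi; have [e e0 He] := pert i.
  have [d [d0 de dg]] : exists d, [/\ 0 < d, d <= e & (i < mI)%N -> 0 <= g 0 i - d].
    case: (ltnP i mI) hi => hi; last by exists e.
    rewrite orbF => gn; have gi : 0 < g 0 i by rewrite lt_def gn g0.
    exists (Num.min e (g 0 i)); rewrite lt_min e0 gi ge_min lexx; split=> // _.
    by rewrite subr_ge0 ge_min lexx orbT.
  have := He (- d); rewrite normrN gtr0_norm // => /(_ de dg).
  by rewrite mulNr oppr_le0 pmulr_rge0.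
have slack i : g 0 i * qf (cons i) x = 0.
  have [->|gn] := eqVneq (g 0 i) 0; first by rewrite mul0r.
  by have -> : qf (cons i) x = 0; rewrite ?mulr0 //; apply: le_anti; rewrite le0 ge0 ?gn.
split; first by rewrite -gt /qgam big1 ?addr0 // => i _; exact: slack.
split=> i hi; first exact: le0.
by apply: le_anti; rewrite [_ <= _]le0 [0 <= _]ge0 // hi orbT.
Qed.

(** When [2 * t] bounds the Lagrangian on Gamma, these are its maximisers, provided the bound is
    attained. *)
Definition max_face x t (g : 'rV[R]_m) : Prop := Gamma A g /\ qgam g x = 2 * t.

(** The Lagrangian is affine in [g], so an average of two values at most [2 * t] with positive
    weights equals [2 * t] only if both do. *)
Lemma max_face_face x t : (forall h, Gamma A h -> qgam h x <= 2 * t) -> face (Gam A) (max_face x t).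
Proof.
move=> hS; split; first by move=> g [].
split=> [g h l [Gg Eg] [Gh Eh] l01|g h l Gg Gh /andP[l0 l1] [_]].
  by split; [exact: Gamma_convex|rewrite qgam_comb Eg Eh; ring].
have hg := hS _ Gg; have hh := hS _ Gh; rewrite qgam_comb => E.
by split; split=> //; nra.
Qed.

Lemma Vspace_dim F : exists d, is_dim (Vspace A F) d.
Proof.
apply: is_dim_exists => [g _|a u v hu hv g Fg]; first by rewrite trmx0 mulmx0.
by rewrite linearP /= mulmxDr -scalemxAr hu // hv // scaler0 addr0.
Qed.

(** Besides the dimension, this supplies a matrix of that rank whose row space contains all
    differences from [s0], the form needed by [exists_orthogonal]. *)
Lemma affdim_exists n (S : 'rV[R]_n -> Prop) s0 : S s0 ->
  exists2 d, is_affdim S d & exists2 M : 'M[R]_n, \rank M = d &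
    forall s, S s -> (s - s0 <= M)%MS.
Proof.
move=> S0; pose T (v : 'rV[R]_n) := exists s, S s /\ v = s - s0.
have [||d dd] := @is_dim_exists R n (Defs.span T).
- by exists 0%N, (fun=> 0), (fun=> 0); split=> [[]|]; rewrite ?big_ord0.
- move=> a u v [k1 [v1 [a1 [h1 ->]]]] [k2 [v2 [a2 [h2 ->]]]].
  exists (k1 + k2)%N.
  exists (fun i => match split i with inl i => v1 i | inr i => v2 i end).
  exists (fun i => match split i with inl i => a * a1 i | inr i => a2 i end).
  split; first by move=> j; case: split.
  rewrite big_split_ord /= scaler_sumr; congr (_ + _); apply: eq_bigr => i _.
    by have := unsplitK (inl i : 'I_k1 + 'I_k2) => /= ->; rewrite scalerA.
  by have := unsplitK (inr i : 'I_k1 + 'I_k2) => /= ->.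
exists d; first by exists s0.
case: dd => M [HM rM]; exists M => // s Ss; apply/HM.
exists 1%N, (fun=> s - s0), (fun=> 1); split; last by rewrite big_ord1 scale1r.
by move=> _; exists s.
Qed.

(** The space V(F) has larger dimension than the span of the differences of the [bgam b g], so it
    contains a nonzero vector orthogonal to that span. *)
Lemma face_direction F g0 : F g0 ->
  (forall dV da : nat, is_dim (Vspace A F) dV -> is_affdim (bimage b F) da ->
     (da + 1 <= dV)%N) ->
  exists2 v : 'rV[R]_N, v != 0 &
    forall g, F g -> Agam A g *m v^T = 0 /\ dot (bgam b g) v = dot (bgam b g0) v.
Proof.
move=> Fg0 hdim; have [dV dimV] := Vspace_dim F.
have [|da dima [W rW HW]] := @affdim_exists N (bimage b F) (bgam b g0).
  by exists g0.
have := hdim _ _ dimV dima; rewrite addn1.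
case: dimV => V [HV <-]; rewrite -rW => lt.
have [v v0 [vV vW]] := exists_orthogonal lt; exists v => // g Fg; split.
  by have /HV/(_ _ Fg) := vV.
have /vW : (bgam b g - bgam b g0 <= W)%MS by apply: HW; exists g.
by rewrite dotDl -scaleN1r dotZl => h; lra.
Qed.

Hypothesis hR : complete_field R.
Hypothesis hfaces : forall F : 'rV[R]_m -> Prop, semidefinite_face A F ->
     forall dV da : nat, is_dim (Vspace A F) dV -> is_affdim (bimage b F) da ->
     (da + 1 <= dV)%N.
Variable gpd : 'rV[R]_m.
Hypothesis Gpd : Gamma A gpd.
Hypothesis pgpd : pd (Agam A gpd).

(** * Activity of generators and the splitting of a point along a line *)

Section Generated.
Variables (I : finType) (s : I -> R) (h : I -> 'rV[R]_m).
Hypothesis gen : forall g, Gamma A g -> exists l : I -> R,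
        [/\ forall i, 0 <= l i, \sum_i l i * s i = 1 & g = \sum_i l i *: h i].
Hypothesis s_ge0 : forall i, 0 <= s i.
Hypothesis gen_pt : forall i, 0 < s i -> Gamma A ((s i)^-1 *: h i).
Hypothesis gen_ray : forall i, s i = 0 -> forall g r, Gamma A g -> 0 <= r -> Gamma A (g + r *: h i).

(** The affine map [g] to [qgam g x - 2 * t], homogenised and evaluated at generator [k]: a multiple
    of its value at a point generator, its slope along a ray. *)
Definition genval k x t : R :=
  s k * (qf ord0 x - 2 * t) + \sum_i h k 0 i * qf (cons i) x.

Lemma qgam_genval g (l : I -> R) x t : \sum_i l i * s i = 1 -> g = \sum_i l i *: h i ->
  qgam g x = 2 * t + \sum_k l k * genval k x t.
Proof.
move=> l1 ->; rewrite /qgam /genval; under [X in _ = _ + X]eq_bigr do rewrite mulrDr mulrA.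
rewrite big_split /= -mulr_suml l1 mul1r addrA (addrC (2 * t)) subrK; congr (_ + _).
under [RHS]eq_bigr do rewrite mulr_sumr.
rewrite exchange_big; apply: eq_bigr => i _ /=; rewrite summxE mulr_suml.
by apply: eq_bigr => k _; rewrite mxE mulrA.
Qed.

Lemma genval_pt k x t : s k != 0 -> genval k x t = s k * (qgam ((s k)^-1 *: h k) x - 2 * t).
Proof.
move=> sk; rewrite /genval /qgam (addrAC (qf ord0 x)) [RHS]mulrDr; congr (_ + _); rewrite mulr_sumr.
by apply: eq_bigr => i _; rewrite mxE !mulrA divff // mul1r.
Qed.

Lemma genval_ray k g r x t : s k = 0 -> qgam (g + r *: h k) x = qgam g x + r * genval k x t.
Proof.
move=> sk; rewrite /genval sk mul0r add0r /qgam -[RHS]addrA mulr_sumr -big_split; congr (_ + _).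
by apply: eq_bigr => i _ /=; rewrite !mxE; ring.
Qed.

Lemma genval_le0_qgam x t : (forall k, genval k x t <= 0) ->
  forall g, Gamma A g -> qgam g x <= 2 * t.
Proof.
move=> hk g /gen[l [l0 l1 E]]; rewrite (qgam_genval x t l1 E) gerDl.
by apply: sumr_le0 => k _; rewrite mulr_ge0_le0.
Qed.

(** Point generators are rescaled elements of Gamma; along a ray of positive slope the Lagrangian
    would be unbounded. *)
Lemma qgam_genval_le0 x t : (forall g, Gamma A g -> qgam g x <= 2 * t) ->
  forall k, genval k x t <= 0.
Proof.
move=> hS k; have [sk|sk] := eqVneq (s k) 0; last first.
  by rewrite genval_pt // mulr_ge0_le0 // subr_le0 hS //; apply: gen_pt; rewrite lt_def sk s_ge0.
rewrite leNgt; apply/negP => v0; have h0 := hS _ Gpd.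
(* This length makes the Lagrangian equal to [2 * t + 1] on the ray from [gpd]. *)
pose r := (2 * t - qgam gpd x + 1) / genval k x t.
have r0 : 0 <= r by rewrite divr_ge0 ?(ltW v0) //; lra.
have := hS _ (gen_ray sk Gpd r0); rewrite (genval_ray gpd r x t sk) /r divfK ?gt_eqF //; lra.
Qed.

Lemma genval_line k x t v r p : genval k (x + r *: v) (t + r * p) =
  genval k x t + r * (s k * (qdir ord0 x v - 2 * p) + \sum_i h k 0 i * qdir (cons i) x v)
  + r ^+ 2 * (s k * bf (A ord0) v v + \sum_i h k 0 i * bf (A (cons i)) v v).
Proof.
rewrite /genval q_line; under eq_bigr do rewrite  q_line.
rewrite (eq_bigr (fun i => h k 0 i * qf (cons i) x + r * (h k 0 i * qdir (cons i) x v)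
  + r ^+ 2 * (h k 0 i * bf (A (cons i)) v v))); last by move=> i _; ring.
by rewrite !big_split /= -!mulr_sumr; ring.
Qed.

(** On the maximising face the Lagrangian along [v] is affine with slope [2 * p], matching the
    change of [2 * t]. An active point generator lies on this face; an active ray added to a face
    element stays on it. *)
Lemma active_line x t v p k :
  (forall g, max_face x t g -> Agam A g *m v^T = 0 /\ dot (bgam b g) v = p) ->
  (exists g, max_face x t g) ->
  genval k x t = 0 -> forall r, genval k (x + r *: v) (t + r * p) = 0.
Proof.
move=> hF [g0 [Gg0 Eg0]] k0 r.
have val g : max_face x t g -> qgam g (x + r *: v) = 2 * (t + r * p).
  move=> Fg; have [Av bv] := hF _ Fg; case: Fg => _ Eg.
  by rewrite qgam_line bv Eg /bf -!mulmxA Av !mulmx0 !mxE; ring.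
have [sk|sk] := eqVneq (s k) 0.
  have F1 : max_face x t (g0 + 1 *: h k).
    by split; [exact: gen_ray|rewrite (genval_ray _ _ _ t sk) k0 mulr0 addr0].
  have := val _ F1; rewrite (genval_ray _ _ _ (t + r * p) sk) (val g0) // mul1r; lra.
rewrite genval_pt // val; first by rewrite subrr mulr0.
split; first by apply: gen_pt; rewrite lt_def sk s_ge0.
move/eqP: k0; rewrite genval_pt // mulf_eq0 (negPf sk) /= subr_eq0.
by move/eqP.
Qed.

Lemma line_hit x t v p : v != 0 -> (forall k, genval k x t <= 0) ->
  (forall k, genval k x t = 0 -> forall r, genval k (x + r *: v) (t + r * p) = 0) ->
  exists r, [/\ 0 < r, forall k, genval k (x + r *: v) (t + r * p) <= 0 &
    exists k, genval k x t < 0 /\ genval k (x + r *: v) (t + r * p) = 0].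
Proof.
move=> v0 hk hact.
pose B k := s k * (qdir ord0 x v - 2 * p) + \sum_i h k 0 i * qdir (cons i) x v.
pose Q k := s k * bf (A ord0) v v + \sum_i h k 0 i * bf (A (cons i)) v v.
have [//|k k0||r [r0 rle [k rk]]] := @quad_first_hit _ I Q B (fun k => genval k x t) hR.
(* A quadratic without constant term that vanishes at 1 and -1 has zero coefficients. *)
- have := hact _ k0 1; have := hact _ k0 (-1); rewrite !genval_line -/(B k) -/(Q k) k0.
  by move=> *; split; lra.
(* The inequality for [gpd] has positive leading coefficient along [v], which bounds the admissible
   parameters. *)
- have [_ ppd] := pgpd; have Q0 := ppd _ v0.
  have [M HM] := quad_bounded (2 * (bf (Agam A gpd) x v + dot (bgam b gpd) v) - 2 * p)
    (qgam gpd x - 2 * t) Q0.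
  exists M => r hr; apply: HM.
  have : qgam gpd (x + r *: v) <= 2 * (t + r * p).
    by apply: genval_le0_qgam => // k; rewrite genval_line; exact: hr.
  by rewrite qgam_line /bf; lra.
exists r; split=> // [j|]; first by rewrite genval_line; exact: rle.
by exists k; rewrite genval_line.
Qed.

(** Induction on the number of inactive generators. The active point generator makes the maximising
    face nonempty, and it remains active at both exit points. *)
Lemma active_in_conv x t : (forall k, genval k x t <= 0) ->
  (exists2 k, 0 < s k & genval k x t = 0) -> conv (D A b c) x t.
Proof.
have [n] := ubnP #|[set k | genval k x t < 0]|.
elim: n x t => // n IH x t; rewrite ltnS => hn hk [k0 sk0 act0].
have hS := genval_le0_qgam hk.
have Fne : max_face x t ((s k0)^-1 *: h k0).
  split; first exact: gen_pt.
  move/eqP: act0; rewrite genval_pt ?lt0r_neq0 // mulf_eq0 (negPf (lt0r_neq0 sk0)) subr_eq0.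
  by move/eqP.
have [[g [[Gg Eg] pg]]|nopd] := classic (exists g, max_face x t g /\ pd (Agam A g)).
  by apply: conv_incl; exact: definite_max_in_D Eg.
have semi : semidefinite_face A (max_face x t).
  by split=> //; split; [exact: max_face_face|exists ((s k0)^-1 *: h k0)].
have [v v0 hv] := face_direction Fne (hfaces semi).
set p := dot (bgam b _) v in hv.
have hact k : genval k x t = 0 -> forall r, genval k (x + r *: v) (t + r * p) = 0.
  by apply: active_line => //; exists ((s k0)^-1 *: h k0).
have step w r' : w != 0 ->
    (forall k, genval k x t = 0 -> forall r, genval k (x + r *: w) (t + r * r') = 0) ->
    exists2 r, 0 < r & conv (D A b c) (x + r *: w) (t + r * r').
  move=> w0 hw; have [r [r0 rle [k [k1 k2]]]] := line_hit w0 hk hw.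
  exists r => //; apply: IH => //; last by exists k0 => //; exact: hw.
  apply: leq_trans hn; apply: proper_card; apply/properP; split.
    apply/subsetP=> j; rewrite !inE => jl; rewrite lt_def hk andbT.
    by apply: contraTneq jl => /esym j0; rewrite hw // ltxx.
  by exists k; rewrite inE // k2 ltxx.
have [r1 r10 c1] := step v p v0 hact.
(* Activity is preserved along the whole line, so the same step applies in the opposite
   direction. *)
have [|k hk0 r|r2 r20 c2] := step (- v) (- p); first by rewrite oppr_eq0.
  by rewrite scalerN -scaleNr mulrN -mulNr; exact: hact.
have r12 : r1 + r2 != 0 by lra.
have -> : x = (r2 / (r1 + r2)) *: (x + r1 *: v) + (r1 / (r1 + r2)) *: (x + r2 *: - v).
  rewrite !scalerDr addrACA -scalerDl -mulrDl (addrC r2) divff // scale1r.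
  rewrite scalerN scalerN !scalerA -scalerBl.
  have -> : r2 / (r1 + r2) * r1 - r1 / (r1 + r2) * r2 = 0 by ring.
  by rewrite scale0r addr0.
have -> : t = r2 / (r1 + r2) * (t + r1 * p) + r1 / (r1 + r2) * (t + r2 * - p) by field.
apply: conv_mix => //; try by rewrite divr_ge0 //; lra.
by rewrite -mulrDl (addrC r2) divff.
Qed.

Lemma D_raise x t r : D A b c x t -> t <= r -> D A b c x r.
Proof. by case=> ? ? tr; split=> //; lra. Qed.

(** The height is first lowered to half the largest Lagrangian value over the point generators,
    which makes one of them active, and is raised back afterwards. *)
Lemma dual_in_conv_gen x t : (forall g, Gamma A g -> qgam g x <= 2 * t) -> conv (D A b c) x t.
Proof.
move=> hS.
(* Since [\sum_i l i * s i = 1] for an element of Gamma, not all generators are rays. *)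
have [k0 sk0] : exists k, 0 < s k.
  have [l [l0 l1 _]] := gen Gpd; apply: NNPP => H; have := oner_neq0 R.
  rewrite -l1 big1 ?eqxx // => k _; have := s_ge0 k.
  by rewrite le_eqVlt => /orP[/eqP <-|sk]; [rewrite mulr0|case: H; exists k].
pose w k := qgam ((s k)^-1 *: h k) x.
have [k sk kmax] := @Order.TotalTheory.arg_maxP _ _ _ k0 (fun k => 0 < s k) w sk0.
apply: (@conv_raise _ _ _ _ (w k / 2)); [exact: D_raise| |]; last first.
  by have := hS _ (gen_pt sk); rewrite -/(w k); lra.
have E2 : 2 * (w k / 2) = w k by field.
apply: active_in_conv; last by exists k; rewrite // genval_pt ?lt0r_neq0 // E2 subrr mulr0.
move=> j; have [sj|sj] := eqVneq (s j) 0.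
  (* For a ray the value does not depend on the height. *)
  have := qgam_genval_le0 hS j; rewrite /genval sj !mul0r; exact.
have sj' : 0 < s j by rewrite lt_def sj s_ge0.
by rewrite genval_pt // pmulr_rle0 // E2 subr_le0; exact: kmax.
Qed.

End Generated.
End QCQPTheory.

(** * The semidefinite relaxation: weak duality and rank-one lifts *)

Lemma sum_block_mx (V : nmodType) (I : finType) m1 m2 n1 n2 (P : I -> 'M[V]_(m1, n1))
    (Q : I -> 'M_(m1, n2)) (S : I -> 'M_(m2, n1)) (T : I -> 'M_(m2, n2)) :
  \sum_i block_mx (P i) (Q i) (S i) (T i) =
  block_mx (\sum_i P i) (\sum_i Q i) (\sum_i S i) (\sum_i T i).
Proof.
elim: (index_enum I) => [|i r IH]; first by rewrite !big_nil block_mx0.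
by rewrite !big_cons IH add_block_mx.
Qed.

Section Relaxation.
Variables (R : realFieldType) (N mI mE : nat).
Local Notation m := (mI + mE)%N.
Variables (A : 'I_m.+1 -> 'M[R]_N) (b : 'I_m.+1 -> 'rV[R]_N) (c : 'I_m.+1 -> R).
Hypothesis hsym : forall i, symmx (A i).

Lemma frob_Qmat i (x : 'rV[R]_N) X :
  frob (Qmat A b c i) (Ymat x X) = c i + 2 * dot (b i) x + frob (A i) X.
Proof.
have db : \sum_j b i 0 j * x 0 j = dot (b i) x by rewrite dot_sumE.
have row0E : \sum_j Qmat A b c i (lshift N 0) j * Ymat x X (lshift N 0) j = c i + dot (b i) x.
  rewrite big_split_ord /= big_ord1 !block_mxEul !mxE /= !mulr1n mulr1 -db; congr (_ + _).
  by apply: eq_bigr => j _; rewrite !block_mxEur.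
have rowSE k : \sum_j Qmat A b c i (rshift 1 k) j * Ymat x X (rshift 1 k) j =
    b i 0 k * x 0 k + \sum_j A i k j * X k j.
  rewrite big_split_ord /= big_ord1 !block_mxEdl !mxE; congr (_ + _).
  by apply: eq_bigr => j _; rewrite !block_mxEdr.
rewrite /frob big_split_ord /= big_ord1 row0E; under eq_bigr do rewrite rowSE.
by rewrite big_split /= db; ring.
Qed.

Lemma Ymat_outer (x : 'rV[R]_N) : Ymat x (x^T *m x) = (row_mx 1 x)^T *m row_mx 1 x.
Proof.
by rewrite tr_row_mx mul_col_row trmx1 !mul1mx mulmx1.
Qed.

Lemma Ymat_psd_sub_outer (x : 'rV[R]_N) X : psd (Ymat x X) -> psd (X - x^T *m x).
Proof.
case=> sY pY; split=> [|w].
  move: sY; rewrite /symmx /Ymat tr_block_mx => /eq_block_mx[_ _ _ sX].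
  by rewrite linearB /= trmx_mul trmxK sX.
(* This test vector cancels the first block, leaving the form of the Schur complement at [w]. *)
have := pY (row_mx (- (w *m x^T)) w); rewrite /Ymat mul_row_block tr_row_mx mul_row_col.
rewrite mulmx1 [- _ + _]addrC subrr mul0mx add0r.
by rewrite mulmxBr mulNmx mulmxA addrC.
Qed.

Lemma q_frob i x X : q A b c i x = frob (Qmat A b c i) (Ymat x X) - frob (A i) (X - x^T *m x).
Proof.
by rewrite frob_Qmat frobD -scaleN1r frobZ frob_outer /q -/(bf _ _ _) -/(dot _ _); ring.
Qed.

Lemma sdp_dual_bound x t X : sdp_feasible A b c x X -> frob (Qmat A b c ord0) (Ymat x X) <= 2 * t ->
  forall g, Gamma A g -> qgam A b c g x <= 2 * t.
Proof.
case=> sX [pY [hI hE]] h0 g [pg g0].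
have := frob_psd_ge0 pg (Ymat_psd_sub_outer pY).
rewrite frobC /Agam frobD frob_sum => hfr.
rewrite /qgam (q_frob _ _ X); under eq_bigr do rewrite (q_frob _ _ X) mulrBr.
rewrite sumrB.
have : \sum_i g 0 i * frob (Qmat A b c (cons i)) (Ymat x X) <= 0.
  apply: sumr_le0 => i _; case: (ltnP i mI) => hi; last by rewrite hE // mulr0.
  by rewrite mulr_ge0_le0 ?g0 ?hI.
move: hfr; rewrite (eq_bigr (fun i => g 0 i * frob (A (cons i)) (X - x^T *m x))) => [|i _].
  by rewrite (frobC _ (A ord0)); lra.
by rewrite frobZ frobC.
Qed.

(** The lift of a convex combination is the same combination of the rank-one lifts, on which pairing
    with [Qmat] returns the values of the quadratics. *)
Lemma conv_D_SDP x t : conv (D A b c) x t -> D_SDP A b c x t.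
Proof.
case=> k [xs [ts [l [HD [l0 [l1 [-> ->]]]]]]].
exists (\sum_j l j *: ((xs j)^T *m xs j)).
have Y_E : Ymat (\sum_j l j *: xs j) (\sum_j l j *: ((xs j)^T *m xs j)) =
    \sum_j l j *: Ymat (xs j) ((xs j)^T *m xs j).
  under [RHS]eq_bigr do rewrite /Ymat scale_block_mx.
  rewrite sum_block_mx -scaler_suml l1 scale1r /Ymat linear_sum /=.
  by congr block_mx; apply: eq_bigr => j _; rewrite linearZ.
have frE i : frob (Qmat A b c i) (\sum_j l j *: Ymat (xs j) ((xs j)^T *m xs j)) =
    \sum_j l j * q A b c i (xs j).
  rewrite frob_sum; apply: eq_bigr => j _.
  by rewrite frobZ (q_frob _ _ ((xs j)^T *m xs j)) subrr frob0 subr0.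
rewrite /sdp_feasible Y_E !frE; split; last first.
  rewrite mulr_sumr; apply: ler_sum => j _; rewrite mulrCA ler_wpM2l //.
  by case: (HD j).
split; first by rewrite /symmx linear_sum /=; apply: eq_bigr => j _; rewrite linearZ /= trmx_mul trmxK.
split; last first.
  split=> i hi; rewrite frE.
    apply: sumr_le0 => j _; rewrite mulr_ge0_le0 //.
    by case: (HD j) => _ [h _]; exact: h.
  rewrite big1 // => j _; case: (HD j) => _ [_ h]; by rewrite h // mulr0.
split=> [|v].
  rewrite /symmx linear_sum /=; apply: eq_bigr => j _.
  by rewrite linearZ /= Ymat_outer trmx_mul trmxK.
rewrite -/(bf _ _ _) bf_summx; apply: sumr_ge0 => j _.
by rewrite Ymat_outer bf_outer mulr_ge0 ?sqr_ge0.
Qed.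

Lemma pd_point_in_Gamma : assumptionA A b c -> exists2 g, Gamma A g & pd (Agam A g).
Proof. by case=> _ [g [g0 pg]]; exists g => //; split=> //; exact: pd_psd. Qed.

End Relaxation.

(** * Equality of the two sets and of the two infima *)

Theorem mainTheorem7 (R : realFieldType) (hR : complete_field R)
  (N mI mE : nat) (hN : (1 <= N)%N) (hm : (1 <= mI + mE)%N)
  (A : 'I_(mI + mE).+1 -> 'M[R]_N) (b : 'I_(mI + mE).+1 -> 'rV[R]_N)
  (c : 'I_(mI + mE).+1 -> R)
  (hsym : forall i, symmx (A i))
  (hA : assumptionA A b c) (hC : assumptionC A)
  (hfaces : forall F : 'rV[R]_(mI + mE) -> Prop, semidefinite_face A F ->
     forall dV da : nat, is_dim (Vspace A F) dV -> is_affdim (bimage b F) da ->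
     (da + 1 <= dV)%N) :
  (forall (x : 'rV[R]_N) (t : R), conv (D A b c) x t <-> D_SDP A b c x t) /\
  same_inf (Opt_values A b c) (OptSDP_values A b c).
Proof.
have [g Gg pg] := pd_point_in_Gamma hA.
have [k [C [d HC]]] := hC.
have [I [s [h [gen s0 gpt gray]]]] := polyhedron_generators HC.
have hconv x t : conv (D A b c) x t <-> D_SDP A b c x t.
  split; first exact: conv_D_SDP.
  case=> X [fX h0]; apply: (dual_in_conv_gen hsym hR hfaces Gg pg gen s0 gpt gray).
  exact: sdp_dual_bound fX h0.
split=> // r; split=> lb v.
  case=> x [X [fX ->]]; set w := frob _ _.
  (* An SDP value [w] corresponds to height [w / 2], hence is an average of numbers [2 * ts j], each
     at least the objective at a feasible [xs j]. *)
  have /hconv[n [xs [ts [l [HD [l0 [l1 [_ E]]]]]]]] : D_SDP A b c x (w / 2).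
    by exists X; split=> //; rewrite -/w; lra.
  have -> : w = \sum_j l j * (2 * ts j).
    by under eq_bigr do rewrite mulrCA; rewrite -mulr_sumr -E; field.
  rewrite -[r]mul1r -[X in X * r <= _]l1 mulr_suml; apply: ler_sum => j _; rewrite ler_wpM2l //.
  have [qj fj] := HD j; apply: le_trans qj; apply: lb.
  by exists (xs j).
(* Conversely, the rank-one lift of a feasible point is feasible for the relaxation with the same
   objective value. *)
case=> x [fx ->]; apply: lb; exists x, (x^T *m x); split; last first.
  by rewrite (q_frob A b c ord0 x (x^T *m x)) subrr frob0 subr0.
have /conv_incl/hconv : D A b c x (q A b c ord0 x / 2) by split=> //; lra.
have fE i : frob (Qmat A b c i) (Ymat x (x^T *m x)) = q A b c i x.
  by rewrite (q_frob A b c i x (x^T *m x)) subrr frob0 subr0.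
case: fx => hI hE _; split; first by rewrite /symmx trmx_mul trmxK.
split; last by split=> i hi; rewrite fE; [exact: hI|exact: hE].
split=> [|v']; first by rewrite /symmx Ymat_outer trmx_mul trmxK.
by rewrite -/(bf _ _ _) Ymat_outer bf_outer sqr_ge0.
Qed.
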